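(* Let $Z$ be a random vector in $\mathbb{R}^d$ and $X_\ell, X_{\ell-1}$ discrete random variables (finite or countable support) such that $\|Z\|_2 \le B$ almost surely for some $B \ge 0$, and such that $X_{\ell-1} \to X_\ell \to Z$ is a Markov chain (i.e. $Z$ and $X_{\ell-1}$ are conditionally independent given $X_\ell$). Then $$\mathbb{E}\big[\|\mathbb{E}[Z\mid X_\ell] - \mathbb{E}[Z\mid X_{\ell-1}]\|_2^2\big] \le 2B^2\, H(X_\ell \mid X_{\ell-1}),$$ where $H(\cdot\mid\cdot)$ denotes conditional Shannon entropy measured in nats. *)

(* Defs.v *)
From HB Require Import structures.
From mathcomp Require Import all_boot all_order all_algebra.
From mathcomp Require Import all_classical all_reals all_analysis.
Set Implicit Arguments. Unset Strict Implicit. Unset Printing Implicit Defensive.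
Import Order.TTheory GRing.Theory Num.Theory.
Local Open Scope classical_set_scope.
Local Open Scope ring_scope.

Definition norm2 {R : realType} {d : nat} (v : 'rV[R]_d) : R :=
  Num.sqrt (\sum_(i < d) v ord0 i ^+ 2).

Definition ev {T I : Type} (X : T -> I) (x : I) : set T := X @^-1` [set x].

(* Elementary conditional expectation of the vector Z given a discrete
   random variable X: on the atom {X = x} it is E[Z 1_{X=x}] / P(X = x)
   (the value on null atoms is irrelevant; here it is 0). *)
Definition condE {d0 : measure_display} {T : measurableType d0} {R : realType}
  (P : probability T R) {I : Type} (X : T -> I) {d : nat} (Z : T -> 'rV[R]_d)
  (t : T) : 'rV[R]_d :=
  \row_(i < d) (fine (\int[P]_(s in ev X (X t)) (Z s ord0 i)%:E)
                  / fine (P (ev X (X t)))).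

Definition sigmaZ {d0 : measure_display} {T : measurableType d0} {R : realType}
  {d : nat} (Z : T -> 'rV[R]_d) : set (set T) :=
  <<s [set E | exists i : 'I_d, exists B : set R,
          measurable B /\ E = (fun t => Z t ord0 i) @^-1` B] >>.

Definition markov_chain {d0 : measure_display} {T : measurableType d0}
  {R : realType} (P : probability T R) {I J : Type} (Y : T -> J) (X : T -> I)
  {d : nat} (Z : T -> 'rV[R]_d) : Prop :=
  forall (E : set T) (x : I) (y : J), sigmaZ Z E ->
    (P (E `&` ev Y y `&` ev X x) * P (ev X x)
     = P (E `&` ev X x) * P (ev Y y `&` ev X x))%E.

Definition cond_entropy {d0 : measure_display} {T : measurableType d0}
  {R : realType} (P : probability T R) {I J : choiceType}
  (X : T -> I) (Y : T -> J) : \bar R :=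
  \esum_(p in [set: I * J])
    (- (fine (P (ev X p.1 `&` ev Y p.2))
        * ln (fine (P (ev X p.1 `&` ev Y p.2)) / fine (P (ev Y p.2)))))%:E.

(* Main.v *)
Require Import Defs.
From HB Require Import structures.
From mathcomp Require Import all_boot all_order all_algebra.
From mathcomp Require Import all_classical all_reals all_analysis.
From mathcomp Require Import measurable_realfun.
From mathcomp Require Import ring lra.
Import Order.TTheory GRing.Theory Num.Theory.
Import numFieldNormedType.Exports.
Local Open Scope classical_set_scope.
Local Open Scope ring_scope.

(* On the atom [Xl = x, Xl1 = y], put q = P(Xl = x | Xl1 = y).  By the Markov
   property E[Z; Xl = x, Xl1 = y] = P(x, y) E[Z | Xl = x], hence
     E[Z | x] - E[Z | y] = (1 - q) E[Z | x] - E[Z; Xl <> x, Xl1 = y] / P(y),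
   where both terms have norm at most (1 - q) B.  The squared distance is
   therefore at most 4 B^2 (1 - q)^2, which is at most 2 B^2 (- ln q) by the
   scalar inequality 2 (1 - q)^2 <= - ln q (Pinsker's inequality for a point
   mass).  Averaging over the atoms gives the conditional entropy. *)

(** * Scalar inequality *)

(** The function f(x) = 2 (1 - x)^2 + ln x has derivative (1 - 2 x)^2 / x >= 0 for x > 0, so f(q) <=
    f(1) = 0. *)
Lemma ln_le_sqr (R : realType) (q : R) : 0 < q <= 1 ->
  2 * (1 - q) ^+ 2 <= - ln q.
Proof.
move=> /andP[q0 q1].
pose f : R -> R := fun x => 2 * (1 - x) ^+ 2 + ln x.
have df (x : R) : 0 < x -> is_derive x 1 f (- 4 * (1 - x) + x^-1).
  move=> x0; rewrite /f.
  have := is_derive1_ln x0 => ?.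
  apply: is_derive_eq; rewrite /GRing.scale/=.
  ring.
suff : f q <= f 1 by rewrite /f ln1 subrr expr0n/= mulr0 addr0; lra.
apply: (@ger0_derive1_ndecr _ f q 1) => //.
- move=> x; rewrite in_itv/= => /andP[qx x1].
  exact: (@ex_derive _ _ _ _ _ _ _ (df x (lt_trans q0 qx))).
- move=> x; rewrite in_itv/= => /andP[qx x1].
  have x0 := lt_trans q0 qx.
  rewrite derive1E (@derive_val _ _ _ _ _ _ _ (df x x0)).
  rewrite (_ : _ + _ = (1 - 2 * x) ^+ 2 / x); last by field; rewrite gt_eqF.
  by rewrite divr_ge0 ?sqr_ge0 ?ltW.
- apply: continuous_in_subspaceT => x; rewrite inE/= in_itv/= => /andP[qx _].
  apply/differentiable_continuous/derivable1_diffP.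
  exact: (@ex_derive _ _ _ _ _ _ _ (df x (lt_le_trans q0 qx))).
Qed.

(** * Integrals of functions with proportional laws *)

(** Absorbing the weight and the domain into the measure lets two weighted integrals be compared by
    comparing measures. *)
Lemma ge0_integral_mscale_mrestr (d : measure_display) (T : measurableType d)
  (R : realType) (mu : {measure set T -> \bar R}) (U : set T) (f : T -> \bar R)
  (a : {nonneg R}) (mU : measurable U) :
  measurable_fun setT f -> (forall x, 0 <= f x)%E ->
  (\int[mscale a (mrestr mu mU)]_x f x = a%:num%:E * \int[mu]_(x in U) f x)%E.
Proof.
move=> mf f0; rewrite ge0_integral_mscale//; congr (_ * _)%E.
rewrite (@ge0_negligible_integral _ _ _ (mrestr mu mU) setT (~` U))//; last 2 first.
- exact: measurableC.
- by rewrite /= /mrestr setICl measure0.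
rewrite setTD setCK; apply: eq_measure_integral => A mA AU.
by rewrite /= /mrestr; congr (mu _); apply/setIidPl.
Qed.

(** The last hypothesis says that the images under [f] of a mu|U and b mu|V coincide, and the
    integral of [f] depends only on the image measure. *)
Lemma Rintegral_eq_law (d : measure_display) (T : measurableType d)
  (R : realType) (mu : {measure set T -> \bar R}) (U V : set T) (f : T -> R)
  (a b : {nonneg R}) :
  measurable U -> measurable V -> measurable_fun setT f ->
  mu.-integrable U (EFin \o f) -> mu.-integrable V (EFin \o f) ->
  (forall E, measurable E ->
     a%:num%:E * mu (f @^-1` E `&` U) = b%:num%:E * mu (f @^-1` E `&` V))%E ->
  a%:num * \int[mu]_(x in U) f x = b%:num * \int[mu]_(x in V) f x.
Proof.
move=> mU mV mf fU fV law.
have part (phi : R -> \bar R) : measurable_fun [set: R] phi ->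
    (forall y, 0 <= phi y)%E ->
    (a%:num%:E * \int[mu]_(x in U) phi (f x) =
     b%:num%:E * \int[mu]_(x in V) phi (f x))%E.
  move=> mphi phi0.
  have mphif : measurable_fun setT (phi \o f) by exact: measurableT_comp.
  rewrite -!ge0_integral_mscale_mrestr//.
  have push (m : {measure set T -> \bar R}) :=
    @ge0_integral_pushforward _ _ _ _ _ _ mf m _ _ measurableT mphi
      (fun y _ => phi0 y).
  rewrite -[LHS]push -[RHS]push.
  by apply: eq_measure_integral => E mE _; exact: law.
have mE : measurable_fun setT (@EFin R) by exact: EFin_measurable.
apply: EFin_inj; rewrite !EFinM !fineK; last 2 first.
- exact: integrable_fin_num.
- exact: integrable_fin_num.
(* [part] needs a nonnegative integrand, so it is applied to the positive and negative parts of the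
   identity, composed with [f]. *)
rewrite !(integralE _ _ (fun x => (f x)%:E)).
rewrite [LHS]muleBr// ?[RHS]muleBr//; last 2 first.
- by rewrite fin_num_adde_defl// fin_numN integrable_neg_fin_num.
- by rewrite fin_num_adde_defl// fin_numN integrable_neg_fin_num.
- have -> : ((fun x => (f x)%:E)^\+ = (@EFin R)^\+ \o f)%E.
    by apply/funext => x; rewrite /= !funeposE.
  have -> : ((fun x => (f x)%:E)^\- = (@EFin R)^\- \o f)%E.
    by apply/funext => x; rewrite /= !funenegE.
  congr (_ - _)%E.
  + by apply: (part (@EFin R)^\+%E) => //; exact: measurable_funepos.
  + by apply: (part (@EFin R)^\-%E) => //; exact: measurable_funeneg.
Qed.

(** * Bounds on integrals of an almost surely bounded vector *)

Lemma sum_sqr_Rintegral_le (d : measure_display) (T : measurableType d)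
  (R : realType) (mu : {finite_measure set T -> \bar R}) (n : nat)
  (Z : T -> 'rV[R]_n) (B : R) (A : set T) :
  measurable A ->
  (forall i, mu.-integrable A (EFin \o (fun t => Z t ord0 i))) ->
  {ae mu, forall t, norm2 (Z t) <= B} ->
  \sum_i (\int[mu]_(t in A) Z t ord0 i) ^+ 2 <= B ^+ 2 * fine (mu A) ^+ 2.
Proof.
move=> mA iZ [N [mN muN ZN]].
pose v i := \int[mu]_(t in A) Z t ord0 i.
set s := \sum_i _; set m := fine (mu A).
(* Removing the null set [N] changes no integral and makes the norm bound hold at every point of the
   domain. *)
have mAN : measurable (A `\` N) by exact: measurableD.
have iZN i : mu.-integrable (A `\` N) (EFin \o (fun t => Z t ord0 i)).
  by apply: integrableS (iZ i) => //; exact: subDsetl.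
have vE i : v i = \int[mu]_(t in A `\` N) Z t ord0 i.
  by rewrite /v /Rintegral (negligible_integral mN mA (iZ i)).
have mE : m = fine (mu (A `\` N)).
  rewrite /m (measureDI mu mA mN) [X in (_ + X)%E](_ : _ = 0%E) ?adde0//.
  exact: (subset_measure0 (measurableI _ _ mA mN) mN (@subIsetr _ _ _) muN).
have m0 : 0 <= m by rewrite fine_ge0.
(* Integrate 0 <= |k v - Z|^2 with v the integral of Z; the optimal k is 1/m. *)
have key k : 2 * k * s <= (k ^+ 2 * s + B ^+ 2) * m.
  rewrite mE -Rintegral_cst//.
  have iS i : mu.-integrable (A `\` N) (EFin \o (fun t => 2 * k * v i * Z t ord0 i)).
    exact: (integrableZl mAN _ (iZN i)).
  rewrite (_ : 2 * k * s =
      \int[mu]_(t in A `\` N) \sum_i (2 * k * v i * Z t ord0 i)); last first.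
    rewrite /Rintegral; under eq_integral do rewrite -sumEFin.
    rewrite (integral_sum mAN iS) mulr_sumr -sum_fine; last first.
      by move=> i _; exact: integrable_fin_num.
    apply: eq_bigr => i _; rewrite -/(Rintegral _ _ _) RintegralZl//.
    by rewrite -vE -/(v i); ring.
  apply: le_Rintegral => //.
  - rewrite [X in mu.-integrable _ X](_ : _ =
        fun t => (\sum_i (2 * k * v i * Z t ord0 i)%:E)%E).
      exact: (integrable_sum mAN _ (fun i _ => iS i)).
    by apply/funext => t; rewrite sumEFin.
  - apply: finite_measure_integrable_cst => //.
  move=> t [At Nt].
  have ZB : \sum_i Z t ord0 i ^+ 2 <= B ^+ 2.
    have : norm2 (Z t) <= B by apply: contrapT => ?; exact/Nt/ZN.
    have s0 : 0 <= \sum_i Z t ord0 i ^+ 2 by apply: sumr_ge0 => i _; exact: sqr_ge0.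
    rewrite -(sqr_sqrtr s0) -/(norm2 (Z t)) => ZB.
    have n0 : 0 <= norm2 (Z t) by rewrite /norm2 sqrtr_ge0.
    by rewrite lerXn2r// nnegrE// (le_trans n0 ZB).
  rewrite (le_trans _ (lerD (lexx _) ZB))// /s mulr_sumr -big_split/=.
  apply: ler_sum => i _; rewrite -/(v i) -subr_ge0.
  rewrite (_ : _ - _ = (k * v i - Z t ord0 i) ^+ 2) ?sqr_ge0//; ring.
(* If [m] = 0, then k = 1 in [key] gives s <= 0. Otherwise k = 1/m gives s / m <= B^2 m. *)
have [m00|m1] := eqVneq m 0.
  by have := key 1; rewrite m00 mulr0 expr0n mulr0 mulr1; lra.
have := key m^-1.
rewrite (_ : (_ + _) * m = m^-1 * s + B ^+ 2 * m); last by field.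
move=> h.
rewrite -(ler_pM2l (_ : 0 < m^-1)); last by rewrite invr_gt0 lt_neqAle eq_sym m1.
rewrite [leRHS](_ : _ = B ^+ 2 * m); last by field.
lra.
Qed.

Lemma coord_le_norm2 (R : realType) (n : nat) (v : 'rV[R]_n) (i : 'I_n) :
  `|v ord0 i| <= norm2 v.
Proof.
rewrite -sqrtr_sqr ler_sqrt; last by apply: sumr_ge0 => j _; exact: sqr_ge0.
by rewrite (bigD1 i)//= lerDl sumr_ge0// => j _; exact: sqr_ge0.
Qed.

Lemma integrable_ae_norm2_le (d : measure_display) (T : measurableType d)
  (R : realType) (mu : {finite_measure set T -> \bar R}) (n : nat)
  (Z : T -> 'rV[R]_n) (B : R) (A : set T) (i : 'I_n) :
  measurable A -> measurable_fun setT (fun t => Z t ord0 i) ->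
  {ae mu, forall t, norm2 (Z t) <= B} ->
  mu.-integrable A (EFin \o (fun t => Z t ord0 i)).
Proof.
move=> mA mZ [N [mN muN ZN]].
have mZA : measurable_fun A (fun t => Z t ord0 i) by exact: measurable_funTS.
apply/(negligible_integrable mN mA _ muN); first exact/measurable_EFinP.
apply: measurable_bounded_integrable.
- exact: measurableD.
- by rewrite ltey_eq fin_num_measure//; exact: measurableD.
- by apply: measurable_funS mZA => //; exact: subDsetl.
exists B; split; first exact: num_real.
move=> M BM t [_ Nt]; apply: (le_trans (coord_le_norm2 _ _ _ _)).
by apply: (le_trans _ (ltW BM)); apply: contrapT => ?; exact/Nt/ZN.
Qed.

(** * Conditional expectations on a joint atom *)

(** Applied to preimages of Borel sets under one coordinate of [Z], the Markov property says that
    the laws of this coordinate on the two atoms are proportional. The cross-multiplied form also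
    covers null atoms. *)
Lemma markov_chain_Rintegral (d0 : measure_display) (T : measurableType d0)
  (R : realType) (P : probability T R) (I J : Type) (Y : T -> J) (X : T -> I)
  (n : nat) (Z : T -> 'rV[R]_n) (i : 'I_n) (x : I) (y : J) :
  measurable (ev X x) -> measurable (ev Y y) ->
  measurable_fun setT (fun t => Z t ord0 i) ->
  P.-integrable (ev X x) (EFin \o (fun t => Z t ord0 i)) ->
  markov_chain P Y X Z ->
  fine (P (ev X x)) * \int[P]_(t in ev Y y `&` ev X x) Z t ord0 i =
  fine (P (ev Y y `&` ev X x)) * \int[P]_(t in ev X x) Z t ord0 i.
Proof.
move=> mX mY mZ iZ markov.
have mYX := measurableI _ _ mY mX.
have PX0 : 0 <= fine (P (ev X x)) by rewrite fine_ge0.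
have PYX0 : 0 <= fine (P (ev Y y `&` ev X x)) by rewrite fine_ge0.
apply: (@Rintegral_eq_law _ _ _ _ _ _ _ (NngNum PX0) (NngNum PYX0)) => //.
  by apply: integrableS iZ => //; exact: subIsetr.
move=> E mE; rewrite /= !fineK ?fin_num_measure// setIA [LHS]muleC [RHS]muleC.
apply: markov; apply: sub_sigma_algebra; exists i, E; split => //.
Qed.

Lemma sum_sqr_condE_sub_le (d0 : measure_display) (T : measurableType d0)
  (R : realType) (P : probability T R) (I J : Type) (Y : T -> J) (X : T -> I)
  (n : nat) (Z : T -> 'rV[R]_n) (B : R) (t : T) :
  (forall i, measurable_fun setT (fun t => Z t ord0 i)) ->
  measurable (ev X (X t)) -> measurable (ev Y (Y t)) ->
  {ae P, forall t, norm2 (Z t) <= B} ->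
  markov_chain P Y X Z ->
  0 < fine (P (ev Y (Y t) `&` ev X (X t))) ->
  \sum_i (condE P X Z t - condE P Y Z t) ord0 i ^+ 2 <=
  4 * B ^+ 2 *
  (1 - fine (P (ev Y (Y t) `&` ev X (X t))) / fine (P (ev Y (Y t)))) ^+ 2.
Proof.
move=> mZ; set x := X t; set y := Y t => mX mY ZB markov.
have mYX := measurableI _ _ mY mX.
have mYDX := measurableD mY mX.
set pxy := fine _ => pxy0; set px := fine (P (ev X x)); set py := fine (P (ev Y y)).
have iZ A i : measurable A -> P.-integrable A (EFin \o (fun t => Z t ord0 i)).
  by move=> mA; exact: integrable_ae_norm2_le ZB.
have px0 : 0 < px.
  apply: (lt_le_trans pxy0); rewrite fine_le ?fin_num_measure//.
  by apply: le_measure; rewrite ?inE//; exact: subIsetr.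
have py0 : 0 < py.
  apply: (lt_le_trans pxy0); rewrite fine_le ?fin_num_measure//.
  by apply: le_measure; rewrite ?inE//; exact: subIsetl.
have rest : fine (P (ev Y y `\` ev X x)) = py - pxy.
  rewrite /py (measureDI P mY mX) fineD ?fin_num_measure// /pxy; ring.
pose a i := \int[P]_(s in ev X x) Z s ord0 i.
pose b i := \int[P]_(s in ev Y y `\` ev X x) Z s ord0 i.
have aB : \sum_i (a i) ^+ 2 <= B ^+ 2 * px ^+ 2.
  by apply: sum_sqr_Rintegral_le ZB => // i; exact: iZ.
have bB : \sum_i (b i) ^+ 2 <= B ^+ 2 * (py - pxy) ^+ 2.
  by rewrite -rest; apply: sum_sqr_Rintegral_le ZB => // i; exact: iZ.
(* With q = pxy / py, this is (1 - q) E[Z | x] minus the contribution to E[Z | y] from outside {X =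
   x}. *)
have E i : (condE P X Z t - condE P Y Z t) ord0 i =
    (1 - pxy / py) / px * a i - b i / py.
  rewrite !mxE -/x -/y -/px -/py -!/(Rintegral _ _ _) -/(a i).
  (* The atom of [Y] is cut along {X = x}; the Markov property turns the inner piece into a multiple
     of [a i]. *)
  have split : \int[P]_(s in ev Y y) Z s ord0 i =
      pxy / px * a i + b i.
    have YE : ev Y y = (ev Y y `&` ev X x) `|` (ev Y y `\` ev X x) by rewrite setUIDK.
    rewrite [in LHS]YE Rintegral_setU//; last 2 first.
    - by rewrite -YE; exact: iZ.
    - by rewrite disj_set2E; apply/eqP/seteqP; split => // s [[_ Xs] [_ /(_ Xs)]].
    congr (_ + _); rewrite -mulrA [_^-1 * _]mulrC mulrA.
    rewrite -markov_chain_Rintegral//; last exact: iZ.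
    by rewrite -/px mulrAC mulfV ?gt_eqF// mul1r.
  rewrite split; field; rewrite !gt_eqF//.
under eq_bigr do rewrite E.
have le2 (u v : R) : (u - v) ^+ 2 <= 2 * u ^+ 2 + 2 * v ^+ 2.
  by rewrite -subr_ge0 (_ : _ - _ = (u + v) ^+ 2) ?sqr_ge0//; ring.
apply: (le_trans (ler_sum _ (fun i _ => le2 _ _))).
rewrite big_split/= -!mulr_sumr.
under eq_bigr do rewrite exprMn.
under [X in _ + 2 * X]eq_bigr do rewrite expr_div_n.
rewrite -mulr_sumr -mulr_suml.
apply: (@le_trans _ _ (2 * (((1 - pxy / py) / px) ^+ 2 * (B ^+ 2 * px ^+ 2)) +
                       2 * (B ^+ 2 * (py - pxy) ^+ 2 / py ^+ 2))).
  apply: lerD; rewrite ler_pM2l//.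
    by rewrite ler_wpM2l ?sqr_ge0.
  by rewrite ler_wpM2r ?invr_ge0 ?sqr_ge0.
(* Each of the two summands equals 2 B^2 (1 - q)^2. *)
rewrite le_eqVlt; apply/orP; left; apply/eqP; field.
by rewrite !gt_eqF.
Qed.

(** * Countable sums and integrals over atoms *)

(** The sum is reindexed along the injection [pickle]; naturals that encode no element of [K]
    contribute 0. *)
Lemma esum_pickle (R : realType) (K : countType) (a : K -> \bar R) :
  (forall k, 0 <= a k)%E ->
  (\esum_(k in [set: K]) a k = \sum_(n <oo) oapp a 0 (@pickle_inv K n))%E.
Proof.
move=> a0.
rewrite nneseries_esumT; last by move=> n; case: pickle_inv.
have -> : (\esum_(k in [set: K]) a k =
           \esum_(k in [set: K]) oapp a 0 (@pickle_inv K (pickle k)))%E.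
  by apply: eq_esum => k _; rewrite pickleK_inv.
have pinj : set_inj [set: K] pickle by move=> k l _ _ /(pcan_inj pickleK).
rewrite -(esum_image setT pickle (fun n => oapp a 0%E (@pickle_inv K n)))//.
rewrite esum_mkcond; apply: eq_esum => n _; case: ifPn => // nK.
case E : (@pickle_inv K n) => [k|//]; case/negP: nK; rewrite inE.
by exists k => //; have := @pickle_invK K n; rewrite E.
Qed.

Lemma esum_countZl (R : realType) (K : countType) (c : R) (a : K -> \bar R) :
  0 <= c -> (forall k, 0 <= a k)%E ->
  (\esum_(k in [set: K]) (c%:E * a k) = c%:E * \esum_(k in [set: K]) a k)%E.
Proof.
move=> c0 a0; rewrite !esum_pickle//; last by move=> k; rewrite mule_ge0.
rewrite -nneseriesZl; last by move=> n _; case: pickle_inv.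
by apply: eq_eseriesr => n _; case: pickle_inv => //=; rewrite mule0.
Qed.

(** A function constant on the atoms of [W] is automatically measurable, since its preimages are
    countable unions of atoms; countable additivity over the partition then applies. *)
Lemma ge0_integral_atoms (d : measure_display) (T : measurableType d)
  (R : realType) (mu : {measure set T -> \bar R}) (K : countType) (W : T -> K)
  (f : T -> \bar R) :
  (forall k, measurable (ev W k)) -> (forall t, 0 <= f t)%E ->
  (forall s t, W s = W t -> f s = f t) ->
  (\int[mu]_t f t = \esum_(k in [set: K]) \int[mu]_(t in ev W k) f t)%E.
Proof.
move=> mW f0 fW.
pose F n := oapp (ev W) set0 (@pickle_inv K n).
have mF n : measurable (F n) by rewrite /F; case: pickle_inv => /=.
have FT : [set: T] = \bigcup_n F n.
  apply/esym; rewrite -subTset => t _; exists (pickle (W t)) => //.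
  by rewrite /F pickleK_inv.
have mf : measurable_fun setT f.
  move=> _ A mA; rewrite setTI.
  rewrite (_ : _ @^-1` A = \bigcup_k (ev W k `&` f @^-1` A)); last first.
    by rewrite -setI_bigcupl; apply/esym/setIidPr => t _; exists (W t).
  apply: countable_bigcupT_measurable; first exact: countableP.
  (* An atom is either contained in the preimage of [A] or disjoint from it. *)
  move=> k; have [[t [Wt At]]|no] := pselect (exists t, (ev W k `&` f @^-1` A) t).
    rewrite (_ : _ `&` _ = ev W k)//; apply/setIidPl => s Ws /=.
    by rewrite (fW s t)//; rewrite Ws Wt.
  rewrite (_ : _ `&` _ = set0)//; apply/seteqP; split => // t ft.
  by apply: no; exists t.
rewrite esum_pickle; last by move=> k; apply: integral_ge0.
rewrite FT ge0_integral_bigcup//; last 2 first.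
- by rewrite -FT.
- apply/trivIsetP => m n _ _ mn; apply/seteqP; split => // t.
  rewrite /F; case Em : (@pickle_inv K m) => [k|]; last by case.
  case En : (@pickle_inv K n) => [l|]; last by case.
  case=> /= Wk Wl; have /= := @pickle_invK K m; have /= := @pickle_invK K n.
  rewrite Em En/= => nE mE; case/eqP: mn.
  by rewrite -mE -nE -Wk -Wl.
apply: eq_eseriesr => n _; rewrite /F; case: pickle_inv => //=.
exact: integral_set0.
Qed.

(** * Averaging over the joint atoms *)

Theorem theorem5 (d0 : measure_display) (T : measurableType d0) (R : realType)
  (P : probability T R) (d : nat) (Z : T -> 'rV[R]_d)
  (I J : countType) (Xl : T -> I) (Xl1 : T -> J) (B : R) :
  (forall i : 'I_d, measurable_fun setT (fun t => Z t ord0 i)) ->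
  (forall x : I, measurable (ev Xl x)) ->
  (forall y : J, measurable (ev Xl1 y)) ->
  0 <= B ->
  {ae P, forall t, norm2 (Z t) <= B} ->
  markov_chain P Xl1 Xl Z ->
  (\int[P]_t ((norm2 (condE P Xl Z t - condE P Xl1 Z t)) ^+ 2)%:E
    <= (2 * B ^+ 2)%:E * cond_entropy P Xl Xl1)%E.
Proof.
move=> mZ mX mY _ ZB markov.
pose W t := (Xl t, Xl1 t).
have WE p : ev W p = ev Xl p.1 `&` ev Xl1 p.2.
  by case: p => x y; apply/seteqP; split => [t [<- <-]|t /= [<- <-]].
have mW p : measurable (ev W p) by rewrite WE; exact: measurableI.
have q01 p : 0 < fine (P (ev W p)) ->
    0 < fine (P (ev W p)) / fine (P (ev Xl1 p.2)) <= 1.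
  move=> p0; have le : fine (P (ev W p)) <= fine (P (ev Xl1 p.2)).
    rewrite fine_le ?fin_num_measure//; apply: le_measure; rewrite ?inE//.
    by rewrite WE; exact: subIsetr.
  have py0 := lt_le_trans p0 le.
  by rewrite divr_gt0//= ler_pdivrMr// mul1r.
have pW0 p : 0 <= fine (P (ev W p)) by rewrite fine_ge0.
rewrite /cond_entropy -esum_countZl; last 2 first.
- by rewrite mulr_ge0 ?sqr_ge0.
- move=> p; rewrite -WE lee_fin oppr_ge0.
  have := pW0 p; rewrite le_eqVlt => /predU1P[<-|p0]; first by rewrite mul0r.
  have /andP[_ q1] := q01 _ p0.
  by rewrite pmulr_rle0// ln_le0.
(* Both conditional expectations depend on the sample point only through [W], so the integrand is
   constant on each joint atom. *)
rewrite (@ge0_integral_atoms _ _ _ _ _ W)//; last 2 first.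
- by move=> t; rewrite lee_fin sqr_ge0.
- by move=> s t [Xst Yst]; rewrite /condE Xst Yst.
apply: le_esum => p _; rewrite -WE.
(* A nonempty atom supplies a point [t] at which to evaluate the constant integrand; an empty one
   contributes 0 to both sides. *)
have [[t Wt]|no] := pselect (exists t, ev W p t); last first.
  rewrite (_ : ev W p = set0); last first.
    by apply/seteqP; split => // t Wt; apply: no; exists t.
  by rewrite integral_set0 measure0 mul0r oppr0 mule0.
rewrite (eq_integral (fun=> (norm2 (condE P Xl Z t - condE P Xl1 Z t) ^+ 2)%:E)).
  rewrite integral_cst//= -(fineK (fin_num_measure P _ (mW p))) -!EFinM lee_fin.
  (* On a null atom the factor P(x, y) = 0 makes both sides vanish, whatever the value of the
     logarithm. *)
  have := pW0 p; rewrite le_eqVlt => /predU1P[<-|p0].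
    by rewrite mul0r oppr0 !mulr0.
  have /ln_le_sqr := q01 _ p0.
  have Wt' : p = (Xl t, Xl1 t) by rewrite -Wt.
  have pE : ev Xl1 (Xl1 t) `&` ev Xl (Xl t) = ev W p by rewrite WE Wt' setIC.
  have := sum_sqr_condE_sub_le _ _ _ _ _ _ _ _ _ _ _ t mZ (mX _) (mY _) ZB markov.
  rewrite pE => /(_ p0).
  rewrite /norm2 sqr_sqrtr; last by apply: sumr_ge0 => i _; exact: sqr_ge0.
  rewrite (_ : ev Xl1 p.2 = ev Xl1 (Xl1 t)); last by rewrite Wt'.
  set q := _ / _; set v := \sum_i _ => vB qB.
  (* After cancelling P(x, y) > 0, the claim is 4 B^2 (1 - q)^2 <= 2 B^2 (- ln q). *)
  rewrite mulrC -mulrN mulrCA ler_pM2l// (le_trans vB)//.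
  rewrite (_ : 4 * _ * _ = 2 * B ^+ 2 * (2 * (1 - q) ^+ 2)); last by ring.
  by rewrite ler_wpM2l// mulr_ge0// sqr_ge0.
move=> s; rewrite inE => Ws; congr ((norm2 _ ^+ 2)%:E).
by have [Xst Yst] : W s = W t; [rewrite Ws Wt|rewrite /condE Xst Yst].
Qed.
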